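(* Let $H_1,\ldots,H_n$ be complete multipartite graphs such that $\beta(H_1)\leq\cdots\leq\beta(H_n)$ and \[\prod_{k\in A}\frac{1-\beta(H_k)}{\beta(H_k)}\geq \frac{1-\beta(H_n)}{\beta(H_n)}\] for all nonempty $A\subseteq[n-1]$. Then \[\Phi(H_1,\nu)=\begin{cases}0,&\nu=0;\\ 1-\beta(H_1),&0<\nu\leq\beta(H_1);\\ 1,&\beta(H_1)<\nu\leq 1,\end{cases}\] and if $n\geq 2$, then \[\Phi(H_1\times\cdots\times H_n,\nu)=\begin{cases}0,&\nu=0;\\ (1-\beta(H_n))\,\Phi\!\left(H_1\times\cdots\times H_{n-1},\dfrac{\nu}{\beta(H_n)}\right),&0<\nu\leq\beta(H_n);\\ 1-\beta(H_n)+\beta(H_n)\,\Phi\!\left(H_1\times\cdots\times H_{n-1},\dfrac{\nu-\beta(H_n)}{1-\beta(H_n)}\right),&\beta(H_n)<\nu\leq 1.\end{cases}\]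
   Context: All graphs are simple and finite. The direct product $H_1\times\cdots\times H_n$ has vertex set $V(H_1)\times\cdots\times V(H_n)$, with two vertices adjacent iff they are adjacent in every coordinate. For a graph $G$, $\beta(G)=\alpha(G)/|V(G)|$, where $\alpha(G)$ is the independence number. $\mu$ denotes the uniform probability measure on $V(G)$, $\mu(S)=|S|/|V(G)|$. For $S\subseteq V(G)$, the vertex boundary is $\partial S=\{w\in V(G):\{v,w\}\in E(G)\text{ for some }v\in S\}$. The vertex isoperimetric profile is $\Phi(G,\nu)=\min\{\mu(\partial S):S\subseteq V(G),\ \mu(S)\geq\nu\}$ for $\nu\in[0,1]$. *)

(* Defs.v *)
From HB Require Import structures.
From mathcomp Require Import all_boot all_order all_algebra.
From mathcomp Require Import reals.

Set Implicit Arguments.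
Unset Strict Implicit.
Unset Printing Implicit Defensive.

Import Order.TTheory GRing.Theory Num.Theory.
Local Open Scope ring_scope.

Record sgraph := SGraph {
  vertex :> finType;
  adj : rel vertex;
  adj_sym : symmetric adj;
  adj_irr : irreflexive adj }.

(* A single part (an edgeless graph) is allowed; [partition] makes the parts
   nonempty, so [P != set0] says that the graph has at least one vertex. *)
Definition complete_multipartite (G : sgraph) : Prop :=
  exists P : {set {set G}},
    [/\ partition P [set: G], P != set0
      & forall x y : G, adj x y = (pblock P x != pblock P y)].

Section DirectProduct.
Variables (n : nat) (n_gt0 : (0 < n)%N) (H : 'I_n -> sgraph).

Definition dprod_vertex : finType := {dffun forall k : 'I_n, H k}.

Definition dprod_adj : rel dprod_vertex :=
  fun x y => [forall k : 'I_n, adj (x k) (y k)].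

Lemma dprod_sym : symmetric dprod_adj.
Proof. by move=> x y; apply: eq_forallb => k; rewrite adj_sym. Qed.

(* The product of no graphs would be a single vertex with a loop. *)
Lemma dprod_irr : irreflexive dprod_adj.
Proof.
by move=> x; apply/negP => /forallP /(_ (Ordinal n_gt0)); rewrite adj_irr.
Qed.

Definition dprod : sgraph := SGraph dprod_sym dprod_irr.

End DirectProduct.

Definition independent (G : sgraph) (S : {set G}) : bool :=
  [forall x in S, forall y in S, ~~ adj x y].

Definition alpha (G : sgraph) : nat :=
  \max_(S : {set G} | independent S) #|S|.

Definition boundary (G : sgraph) (S : {set G}) : {set G} :=
  [set w | [exists v in S, adj v w]].

Section Measure.
Variable R : realType.

Definition beta (G : sgraph) : R := (alpha G)%:R / #|G|%:R.

Definition mu (G : sgraph) (S : {set G}) : R := #|S|%:R / #|G|%:R.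

(* [set: G] is feasible whenever nu <= 1 and G has a vertex, so the minimum is
   then attained; outside that range Phi is a junk value. *)
Definition Phi (G : sgraph) (nu : R) : R :=
  mu (boundary [arg min_(S < [set: G] | nu <= mu S) mu (boundary S)]%O).

End Measure.

Definition init_factors n (H : 'I_n.+1 -> sgraph) : 'I_n -> sgraph :=
  fun k => H (widen_ord (leqnSn n) k).

(* Main.v *)
Require Import Defs.
From HB Require Import structures.
From mathcomp Require Import all_boot all_order all_algebra.
From mathcomp Require Import reals lra ring zify.

Set Implicit Arguments.
Unset Strict Implicit.
Unset Printing Implicit Defensive.

Import Order.TTheory GRing.Theory Num.Theory.
Local Open Scope ring_scope.

(** Write [D x t] when some vertex set of density at least [x] has boundary of
    density at most [t].  Taking complements of boundaries makes [D] invariant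
    under [(x, t) |-> (1 - t, 1 - x)].

    Let [K] be complete multipartite with [b = beta K] and
    [rho = (1 - b) / b].  A subset [S] of [G x K] can be compressed: with [U]
    the projection of [S] to [G], and [W] the set of points of [G] whose fibre
    meets two parts of [K], the set [U x (largest part) + W x K] is at least as
    large as [S] and its boundary is at most as large.  So the sets of [G x K]
    amount to nested pairs [W] in [U], with density [b |U| + (1 - b) |W|] and
    boundary [(1 - b) |dU| + b |dW|].  The formula of the theorem says that
    [W] empty or [U] full is optimal; by the duality it follows from
    [f (x + rho y) <= f x + f y / rho] for [y <= x], where [f = Phi G].

    That inequality, with any [r] below all products of the ratios [rho_k] in
    place of [rho], is proved by induction on the number of factors.  It is
    applied coordinatewise to the pairs describing [x] and [y]; if the first
    coordinate overflows 1, the excess is moved to the second one, at the price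
    given by the inequality for [r / rho_k], which is why all products of
    ratios have to be bounded. *)

(** * Regions of attainable pairs *)

Section Regions.
Variable R : realType.
Implicit Types (D : R -> R -> Prop) (x y t u r b z : R).

(** What is needed of the attainable pairs of a graph. [region_top] expresses that no vertex is
    isolated; it fails for a product with an edgeless factor, so the case [b = 1] is treated
    apart. *)
Record region D : Prop := Region {
  region_bounds : forall x t, D x t -> [/\ 0 <= x, x <= 1, 0 <= t & t <= 1];
  region_mono : forall x t x' t',
    D x t -> 0 <= x' -> x' <= x -> t <= t' -> t' <= 1 -> D x' t';
  region00 : D 0 0;
  region11 : D 1 1;
  region_dual : forall x t, D x t -> D (1 - t) (1 - x);
  region_top : forall t, D 1 t -> t = 1 }.

(** The inequality [f (x + r y) <= f x + f y / r], truncated to stay in the unit square. For [r > 1]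
    it may fail at [x = 0 < y], hence the order condition. *)
Definition subadditive r D := forall x y t u, D x t -> D y u ->
  r <= 1 \/ y <= x -> D (Num.min 1 (x + r * y)) (Num.min 1 (t + u / r)).

(** Only the densities are ordered here; the underlying sets need not be nested, so a priori [mix]
    may contain more than the sets of the product attain. *)
Definition mix b D x t := exists x1 x2 t1 t2,
  [/\ D x1 t1, D x2 t2, x2 <= x1 /\ t2 <= t1 &
      x <= b * x1 + (1 - b) * x2 /\ (1 - b) * t1 + b * t2 <= t].

(* This is [subadditive r D] for the dual pairs [(1 - u, 1 - y)] and
   [(1 - t, 1 - x)]. *)
Lemma subadditive_dual D r x y t u : region D -> subadditive r D -> 0 < r ->
    D x t -> D y u -> r <= 1 \/ y <= x -> 0 < y - (1 - x) / r ->
  D (y - (1 - x) / r) (u - r * (1 - t)).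
Proof.
move=> rD sD r0 Dxt.
(* Here [u] is generalized, and [r <= 1 \/ u <= t] is the order condition for the dual pairs. If it
   fails, then [y <= x], so [D y t] holds and [t] can replace the larger [u]. *)
wlog: u / r <= 1 \/ u <= t.
  move=> hw Dyu [r1|yx] z0; first by apply: hw => //; left.
  have [ut|tu] := leP u t; first by apply: hw => //; [right|right].
  have [y0 y1 u0 u1] := region_bounds rD Dyu.
  have [x0 x1 t0 t1] := region_bounds rD Dxt.
  have Dyt : D y t by apply: (region_mono rD Dxt).
  have Dz := hw t (or_intror (lexx _)) Dyt (or_intror yx) z0.
  apply: (region_mono rD Dz) => //; first exact: ltW.
    by rewrite lerD2r ltW.
  have : 0 <= r * (1 - t) by rewrite mulr_ge0 ?subr_ge0 // ltW.
  by lra.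
move=> rut Dyu _ z0.
have [y0 y1 u0 u1] := region_bounds rD Dyu.
have [x0 x1 t0 t1] := region_bounds rD Dxt.
have ord' : r <= 1 \/ 1 - t <= 1 - u by case: rut => ?; [left|right; lra].
have := sD _ _ _ _ (region_dual rD Dyu) (region_dual rD Dxt) ord'.
move/(region_dual rD).
have rt0 : 0 <= r * (1 - t) by rewrite mulr_ge0 ?subr_ge0 // ltW.
have xr0 : 0 <= (1 - x) / r by rewrite divr_ge0 ?subr_ge0 // ltW.
have -> : Num.min 1 (1 - y + (1 - x) / r) = 1 - (y - (1 - x) / r).
  by rewrite min_r; [ring|lra].
rewrite subKr.
have [h|h] := leP (1 - u + r * (1 - t)) 1.
  by have -> : 1 - (1 - u + r * (1 - t)) = u - r * (1 - t) by ring.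
(* The positive density [z = y - (1 - x) / r] would have boundary 0; the dual pair [(1, 1 - z)]
   contradicts [region_top]. *)
rewrite subrr => /(region_dual rD); rewrite subr0 => /(region_top rD).
by lra.
Qed.

(** With [rho = (1 - b) / b], the density is [b * (x1 + rho * x2)] and the boundary
    [(1 - b) * (t1 + t2 / rho)], so subadditivity moves everything into the first coordinate. For
    [x > b] the dual form fills the first coordinate and leaves the rest in the second. *)
Lemma mix_explicit D b x t : region D -> 0 < b -> b < 1 ->
    subadditive ((1 - b) / b) D -> mix b D x t -> 0 <= x -> t <= 1 ->
  if x <= b then D (x / b) (Num.min 1 (t / (1 - b)))
  else D ((x - b) / (1 - b)) ((t - (1 - b)) / b).
Proof.
move=> rD b0 b1 sD [x1 [x2 [t1 [t2 [D1 D2 [x21 t21] [hx ht]]]]]] x0 tle1.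
have b1' : 0 < 1 - b by lra.
have bn0 : b != 0 by rewrite gt_eqF.
have bn1 : 1 - b != 0 by rewrite gt_eqF.
have rho0 : 0 < (1 - b) / b by rewrite divr_gt0.
have [x10 x11 t10 t11] := region_bounds rD D1.
have [x20 x2_1 t20 t2_1] := region_bounds rD D2.
case: ifPn => [xb|]; last first.
  rewrite -ltNge => xb.
  have Ez : x2 - (1 - x1) / ((1 - b) / b) = (b * x1 + (1 - b) * x2 - b) / (1 - b).
    by field; rewrite bn0 bn1.
  have Et : t2 - (1 - b) / b * (1 - t1) = ((1 - b) * t1 + b * t2 - (1 - b)) / b.
    by field.
  have z0 : 0 < x2 - (1 - x1) / ((1 - b) / b) by rewrite Ez divr_gt0 //; lra.
  have := subadditive_dual rD sD rho0 D1 D2 (or_intror x21) z0.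
  rewrite Ez Et => Dz; apply: (region_mono rD Dz).
  - by rewrite divr_ge0 //; lra.
  - by rewrite ler_pM2r ?invr_gt0 //; lra.
  - by rewrite ler_pM2r ?invr_gt0 //; lra.
  - by rewrite ler_pdivrMr //; lra.
have Ds := sD _ _ _ _ D1 D2 (or_intror x21).
have Ex : x1 + (1 - b) / b * x2 = (b * x1 + (1 - b) * x2) / b by field.
have Et : t1 + t2 / ((1 - b) / b) = ((1 - b) * t1 + b * t2) / (1 - b).
  by field; rewrite bn0 bn1.
rewrite {}Ex {}Et in Ds; apply: (region_mono rD Ds).
- by rewrite divr_ge0 // ltW.
- by rewrite le_min !ler_pdivrMr // mul1r xb mulfVK.
- by apply: le_min2 => //; rewrite ler_pM2r ?invr_gt0.
- by rewrite ge_min lexx.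
Qed.

Lemma subadditive_mix_witnesses D b r x1 x2 t1 t2 y1 y2 u1 u2 x y t u :
    region D -> 0 < b -> b < 1 -> 0 < r -> r <= (1 - b) / b ->
    subadditive r D -> subadditive (r / ((1 - b) / b)) D ->
    D x1 t1 -> D x2 t2 -> x2 <= x1 -> t2 <= t1 ->
    x <= b * x1 + (1 - b) * x2 -> (1 - b) * t1 + b * t2 <= t ->
    D y1 u1 -> D y2 u2 -> y2 <= y1 -> u2 <= u1 ->
    y <= b * y1 + (1 - b) * y2 -> (1 - b) * u1 + b * u2 <= u ->
    (r <= 1 \/ (y1 <= x1 /\ y2 <= x2)) ->
  mix b D (Num.min 1 (x + r * y)) (Num.min 1 (t + u / r)).
Proof.
move=> rD b0 b1 r0 r_rho sD sD' D1 D2 x21 t21 hx ht E1 E2 y21 u21 hy hu hr.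
have b1' : 0 < 1 - b by lra.
have bn0 : b != 0 by rewrite gt_eqF.
have bn1 : 1 - b != 0 by rewrite gt_eqF.
have rn0 : r != 0 by rewrite gt_eqF.
have rho0 : 0 < (1 - b) / b by rewrite divr_gt0.
have [x10 x11 t10 t11] := region_bounds rD D1.
have [x20 x2_1 t20 t2_1] := region_bounds rD D2.
have [y10 y11 u10 u11] := region_bounds rD E1.
have [y20 y2_1 u20 u2_1] := region_bounds rD E2.
have ry : r * y <= b * (r * y1) + (1 - b) * (r * y2).
  by rewrite !(mulrCA _ r) -mulrDr ler_pM2l.
have ur : (1 - b) * (u1 / r) + b * (u2 / r) <= u / r.
  by rewrite !mulrA -mulrDl ler_pM2r ?invr_gt0.
have r1 : r <= 1 \/ y1 <= x1 by case: hr => [|[]]; [left|right].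
have r2 : r <= 1 \/ y2 <= x2 by case: hr => [|[]]; [left|right].
have F1 := sD _ _ _ _ D1 E1 r1.
have F2 := sD _ _ _ _ D2 E2 r2.
have ry21 : r * y2 <= r * y1 by rewrite ler_pM2l.
have ur21 : u2 / r <= u1 / r by rewrite ler_pM2r ?invr_gt0.
have ur0 : 0 <= u2 / r by rewrite divr_ge0 // ltW.
have [noov|ov] := leP (x1 + r * y1) 1.
  exists (Num.min 1 (x1 + r * y1)), (Num.min 1 (x2 + r * y2)),
    (Num.min 1 (t1 + u1 / r)), (Num.min 1 (t2 + u2 / r)).
  split=> //; split.
  - by apply: le_min2 => //; lra.
  - by apply: le_min2 => //; lra.
  (* Since [x2 + r * y2 <= x1 + r * y1 <= 1], neither density is truncated. *)
  - by rewrite (min_r noov) (min_r (_ : x2 + r * y2 <= 1)) ?ge_min; [apply/orP; right|]; lra.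
  - rewrite le_min; apply/andP; split.
      have m1 : Num.min 1 (t1 + u1 / r) <= 1 by rewrite ge_min lexx.
      have m2 : Num.min 1 (t2 + u2 / r) <= 1 by rewrite ge_min lexx.
      by nra.
    have m1 : Num.min 1 (t1 + u1 / r) <= t1 + u1 / r by rewrite ge_min lexx orbT.
    have m2 : Num.min 1 (t2 + u2 / r) <= t2 + u2 / r by rewrite ge_min lexx orbT.
    by nra.
(* Overflow: [r * z] is the excess of the first coordinate; it contributes
   [(r / rho) * z] to the second one. *)
pose z := y1 - (1 - x1) / r.
have z0 : 0 < z by rewrite /z subr_gt0 ltr_pdivrMr // mulrC; lra.
have Dz : D z (u1 - r * (1 - t1)) := subadditive_dual rD sD r0 D1 E1 r1 z0.
set s := r / ((1 - b) / b) in sD'.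
have s1 : s <= 1 by rewrite /s ler_pdivrMr // mul1r.
have s0 : 0 < s by rewrite /s divr_gt0.
have F := sD' _ _ _ _ F2 Dz (or_introl s1).
set U := Num.min 1 (_ + s * z) in F.
set T := Num.min 1 (_ + _ / s) in F.
exists 1, U, 1, T; split=> //; first exact: region11 rD.
- by split; rewrite ge_min lexx.
- have [U0 U1 T0 T1] := region_bounds rD F.
  split.
    rewrite mulr1 ge_min; have [->|U_lt1] := eqVneq U 1; first by rewrite mulr1 subrKC lexx.
    apply/orP; right.
    have {}U_lt1 : U < 1 by rewrite lt_neqAle U_lt1.
    have sz0 : 0 < s * z by rewrite mulr_gt0.
    have UE : U = x2 + r * y2 + s * z.
      move: U_lt1; rewrite /U; case: (leP (x2 + r * y2) 1) => c1.
        by case: (leP (x2 + r * y2 + s * z) 1) => // _; rewrite ltxx.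
      by case: (leP (1 + s * z) 1) => c2; lra.
    rewrite UE.
    (* As [(1 - b) * s = b * r], the excess keeps its whole weight when moved. *)
    have -> : (1 - b) * (x2 + r * y2 + s * z) =
       (1 - b) * (x2 + r * y2) + b * (x1 + r * y1 - 1).
      by rewrite /s /z; field; rewrite bn0 bn1 rn0.
    by lra.
  have bT : b * T <= b by rewrite ger_pMr.
  rewrite mulr1 le_min; apply/andP; split; first by lra.
  have : T <= t2 + u2 / r + (u1 - r * (1 - t1)) / s.
    rewrite /T ge_min; apply/orP; right.
    by rewrite lerD2r ge_min lexx orbT.
  rewrite -(ler_pM2l b0).
  (* The price of the move is exactly what is saved when [t1 + u1 / r] drops to 1 in the first
     coordinate. *)
  have -> : b * (t2 + u2 / r + (u1 - r * (1 - t1)) / s) =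
    b * (t2 + u2 / r) + (1 - b) * (u1 / r + t1 - 1).
    by rewrite /s; field; rewrite bn0 bn1 rn0.
  by lra.
Qed.

(** For [r > 1] both coordinates have to be ordered, which [y <= x] does not give for arbitrary
    witnesses. They are replaced by those of [mix_explicit], with densities [(x / b, 0)] or
    [(1, (x - b) / (1 - b))], which increase with [x]. *)
Lemma subadditive_mix D b r : region D -> 0 < b -> b < 1 -> 0 < r ->
    r <= (1 - b) / b -> subadditive r D -> subadditive (r / ((1 - b) / b)) D ->
    r <= 1 \/ subadditive ((1 - b) / b) D ->
  forall x y t u, 0 <= x -> 0 <= y -> t <= 1 -> u <= 1 ->
    mix b D x t -> mix b D y u -> r <= 1 \/ y <= x ->
  mix b D (Num.min 1 (x + r * y)) (Num.min 1 (t + u / r)).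
Proof.
move=> rD b0 b1 r0 r_rho sD sD' hr x y t u x0 y0 t1' u1' mx my hxy.
have [r1|r1] := leP r 1.
  case: mx => [x1 [x2 [t1 [t2 [D1 D2 [x21 t21] [hx ht]]]]]].
  case: my => [y1 [y2 [u1 [u2 [E1 E2 [y21 u21] [hy hu]]]]]].
  by apply: (@subadditive_mix_witnesses D b r x1 x2 t1 t2 y1 y2 u1 u2) => //; left.
have yx : y <= x by case: hxy => //; lra.
have {}hr : subadditive ((1 - b) / b) D by case: hr => //; lra.
have b1' : 0 < 1 - b by lra.
have bn0 : b != 0 by rewrite gt_eqF.
have bn1 : 1 - b != 0 by rewrite gt_eqF.
have lowt c : (1 - b) * Num.min 1 (c / (1 - b)) <= c.
  rewrite -[leRHS](divfK bn1) [leRHS]mulrC ler_pM2l //.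
  by rewrite ge_min lexx orbT.
have mt c : 0 <= c -> 0 <= Num.min 1 (c / (1 - b)).
  by move=> c0; rewrite le_min ler01 divr_ge0 // ltW.
have D0 := region00 rD; have D1 := region11 rD.
have := mix_explicit rD b0 b1 hr mx x0 t1'.
have := mix_explicit rD b0 b1 hr my y0 u1'.
case: ifPn => [yb|]; last rewrite -ltNge => yb.
  case: ifPn => [xb Dy Dx|]; last rewrite -ltNge => xb Dy Dx.
    have [_ _ ? _] := region_bounds rD Dx.
    have [? _ ? _] := region_bounds rD Dy.
    apply: (subadditive_mix_witnesses rD b0 b1 r0 r_rho sD sD' Dx D0 _ _ _ _ Dy D0) => //.
    - by rewrite divr_ge0 // ltW.
    - by rewrite mulr0 addr0 mulrC divfK.
    - by rewrite mulr0 addr0.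
    - by rewrite mulr0 addr0 mulrC divfK.
    - by rewrite mulr0 addr0.
    - by right; rewrite ler_pM2r ?invr_gt0.
  have [? ? ? ?] := region_bounds rD Dx.
  have [? ? ? _] := region_bounds rD Dy.
  apply: (subadditive_mix_witnesses rD b0 b1 r0 r_rho sD sD' D1 Dx _ _ _ _ Dy D0) => //.
  - by rewrite (mulrC (1 - b)) divfK //; lra.
  - by rewrite (mulrC b) divfK //; lra.
  - by rewrite mulr0 addr0 mulrC divfK.
  - by rewrite mulr0 addr0.
  - by right.
case: ifPn => [xb|]; last rewrite -ltNge => xb Dy Dx; first lra.
have [? ? ? ?] := region_bounds rD Dx.
have [? ? ? ?] := region_bounds rD Dy.
apply: (subadditive_mix_witnesses rD b0 b1 r0 r_rho sD sD' D1 Dx _ _ _ _ D1 Dy) => //.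
- by rewrite (mulrC (1 - b)) divfK //; lra.
- by rewrite (mulrC b) divfK //; lra.
- by rewrite (mulrC (1 - b)) divfK //; lra.
- by rewrite (mulrC b) divfK //; lra.
- by right; split=> //; rewrite ler_pM2r ?invr_gt0 //; lra.
Qed.

Lemma mix_top D b t : region D -> 0 < b -> b < 1 -> mix b D 1 t -> 1 <= t.
Proof.
move=> rD b0 b1 [x1 [x2 [t1 [t2 [D1 D2 [x21 t21] [hx ht]]]]]].
have [x10 x11 t10 t11] := region_bounds rD D1.
have [x20 x2_1 t20 t2_1] := region_bounds rD D2.
have E2 : x2 = 1 by nra.
have E1 : x1 = 1 by nra.
rewrite E1 in D1; rewrite E2 in D2.
by rewrite (region_top rD D1) (region_top rD D2) in ht; lra.
Qed.

End Regions.

(** * Boundaries and densities *)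

(** Stated for arbitrary relations because the induction starts from a single looped vertex, which
    is no [sgraph]. *)
Definition vboundary (V : finType) (e : rel V) (S : {set V}) : {set V} :=
  [set w | [exists v in S, e v w]].

Lemma vboundaryP (V : finType) (e : rel V) (S : {set V}) w :
  reflect (exists2 v, v \in S & e v w) (w \in vboundary e S).
Proof. by rewrite inE; apply: exists_inP. Qed.

Lemma vboundary0 (V : finType) (e : rel V) : vboundary e set0 = set0.
Proof.
by apply/setP => w; rewrite in_set0; apply/vboundaryP => -[v]; rewrite in_set0.
Qed.

Lemma vboundaryU (V : finType) (e : rel V) (S T : {set V}) :
  vboundary e (S :|: T) = vboundary e S :|: vboundary e T.
Proof.
apply/setP => w; rewrite in_setU; apply/vboundaryP/orP => [[v]|].
  by rewrite in_setU => /orP[] h evw; [left|right]; apply/vboundaryP; exists v.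
by case=> /vboundaryP[v h evw]; exists v; rewrite // in_setU h ?orbT.
Qed.

Lemma vboundaryS (V : finType) (e : rel V) (S T : {set V}) :
  S \subset T -> vboundary e S \subset vboundary e T.
Proof. by move=> sST; rewrite -(setUidPr sST) vboundaryU subsetUl. Qed.

Section Profile.
Variable R : realType.

Definition density (V : finType) (S : {set V}) : R := #|S|%:R / #|V|%:R.

Definition profile (V : finType) (e : rel V) (x t : R) : Prop :=
  [/\ 0 <= x, t <= 1
    & exists S : {set V}, x <= density S /\ density (vboundary e S) <= t].

Lemma density_ge0 (V : finType) (S : {set V}) : 0 <= density S.
Proof. by rewrite divr_ge0. Qed.

Lemma density_le1 (V : finType) (S : {set V}) : density S <= 1.
Proof.
have [V0|V0] := posnP #|V|; first by rewrite /density V0 invr0 mulr0.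
by rewrite ler_pdivrMr ?ltr0n // mul1r ler_nat max_card.
Qed.

Lemma densityT (V : finType) : (0 < #|V|)%N -> density [set: V] = 1.
Proof. by move=> V0; rewrite /density cardsT divff // pnatr_eq0 -lt0n. Qed.

Lemma density0 (V : finType) : density (set0 : {set V}) = 0.
Proof. by rewrite /density cards0 mul0r. Qed.

Lemma densityC (V : finType) (S : {set V}) : (0 < #|V|)%N ->
  density (~: S) = 1 - density S.
Proof.
move=> V0; have := cardsC S; rewrite /density => /(congr1 (fun m => m%:R : R)).
rewrite natrD => h; rewrite -[X in X - _](@divff _ #|V|%:R) ?pnatr_eq0 -?lt0n //.
by rewrite -mulrBl -h addrAC subrr add0r.
Qed.

Lemma densityS (V : finType) (S T : {set V}) :
  S \subset T -> density S <= density T.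
Proof. by move=> sST; rewrite ler_wpM2r ?invr_ge0 ?ler_nat ?subset_leq_card. Qed.

End Profile.

Section ProfileRegion.
Variables (R : realType) (V : finType) (e : rel V).
Hypotheses (V_gt0 : (0 < #|V|)%N) (e_sym : symmetric e).

Lemma profile_bounds x t :
  profile e x t -> [/\ 0 <= x :> R, x <= 1, 0 <= t & t <= 1].
Proof.
case=> x0 t1 [S [hx ht]]; split=> //.
- exact: le_trans hx (density_le1 _ _).
- exact: le_trans (density_ge0 _ _) ht.
Qed.

Lemma profile_mono (x t x' t' : R) :
  profile e x t -> 0 <= x' -> x' <= x -> t <= t' -> t' <= 1 -> profile e x' t'.
Proof.
move=> [x0 t1 [S [hx ht]]] x'0 xx tt t'1; split=> //; exists S; split.
  exact: le_trans xx hx.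
exact: le_trans ht tt.
Qed.

Lemma profile_region :
  (forall t : R, profile e 1 t -> 1 <= t) -> region (@profile R V e).
Proof.
move=> top; split.
- exact: profile_bounds.
- exact: profile_mono.
- by split=> //; exists set0; rewrite vboundary0 density0.
- by split=> //; exists setT; rewrite densityT //; split=> //; apply: density_le1.
- move=> x t xt; have [x0 x1 t0 t1] := profile_bounds xt.
  case: xt => _ _ [S [hx ht]].
  split; [by lra|by lra|exists (~: vboundary e S)].
  rewrite densityC //; split; first by lra.
  (* A vertex of [S] has all its neighbours in the boundary of [S]. *)
  have h : vboundary e (~: vboundary e S) \subset ~: S.
    apply/subsetP => w /vboundaryP[v]; rewrite !in_setC => vS evw.
    by apply: contra vS => wS; apply/vboundaryP; exists w => //; rewrite e_sym.
  by apply: le_trans (densityS _ h) _; rewrite densityC //; lra.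
- move=> t ht; have [_ _ _ t1] := profile_bounds ht.
  by apply/eqP; rewrite eq_le t1 top.
Qed.

End ProfileRegion.

Lemma profile_bij (R : realType) (V V' : finType) (e : rel V) (e' : rel V')
    (f : V -> V') (x t : R) : bijective f ->
  (forall v w, e v w = e' (f v) (f w)) -> profile e x t -> profile e' x t.
Proof.
move=> bf ef [x0 t1 [S [hx ht]]]; split=> //; exists (f @: S).
have injf := bij_inj bf.
rewrite /density card_imset // -(bij_eq_card bf); split=> //.
apply: le_trans ht; rewrite /density (bij_eq_card bf).
rewrite ler_wpM2r ?invr_ge0 // ler_nat -(card_imset (vboundary e S) injf).
apply/subset_leq_card/subsetP => w' /vboundaryP[_ /imsetP[v vS ->]].
have [g fK gK] := bf; rewrite -[w']gK -ef => evw.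
by apply: imset_f; apply/vboundaryP; exists v.
Qed.

(** * Parts and independence number of a complete multipartite graph *)

Lemma complete_multipartite_trans (G : sgraph) : complete_multipartite G ->
  forall x y z : G, adj x y -> adj x z || adj y z.
Proof.
move=> [P [_ _ adjE]] x y z; rewrite !adjE -negb_and.
by apply: contra => /andP[/eqP-> /eqP->].
Qed.

Lemma complete_multipartite_gt0 (G : sgraph) :
  complete_multipartite G -> (0 < #|G|)%N.
Proof.
move=> [P [/and3P[_ _ P0] /set0Pn[A AP] _]].
have [A0|[x _]] := set_0Vmem A; first by rewrite -A0 AP in P0.
by apply/card_gt0P; exists x.
Qed.

Lemma independent_leq_alpha (G : sgraph) (S : {set G}) :
  independent S -> (#|S| <= alpha G)%N.
Proof. by move=> iS; rewrite /alpha (leq_bigmax_cond _ iS). Qed.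

Lemma nonadj_leq_alpha (G : sgraph) (x : G) : complete_multipartite G ->
  (#|[set y | ~~ adj x y]| <= alpha G)%N.
Proof.
move=> cG; apply: independent_leq_alpha.
apply/forall_inP => y; rewrite inE => xy; apply/forall_inP => z; rewrite inE.
apply: contra => /(complete_multipartite_trans cG x).
by rewrite !(adj_sym _ x) (negPf xy).
Qed.

(** A maximum independent set is nonempty and lies in the part of any of its vertices, and that part
    is itself independent. *)
Lemma nonadj_eq_alpha (G : sgraph) : complete_multipartite G ->
  exists x : G, #|[set y | ~~ adj x y]| = alpha G.
Proof.
move=> cG; have /card_gt0P[x0 _] := complete_multipartite_gt0 cG.
have i0 : independent (set0 : {set G}) by apply/forall_inP => x; rewrite inE.
have : (0 < #|[pred S : {set G} | independent S]|)%N.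
  by apply/card_gt0P; exists set0; rewrite inE.
move/(eq_bigmax_cond (fun S : {set G} => #|S|)) => [S iS aS].
have {aS} aS : #|S| = alpha G by rewrite -aS; apply: eq_bigl => A; rewrite inE.
have i1 : independent [set x0].
  apply/forall_inP => x /set1P->; apply/forall_inP => y /set1P->.
  by rewrite adj_irr.
have : (0 < #|S|)%N by rewrite aS -(cards1 x0) independent_leq_alpha.
rewrite card_gt0 => /set0Pn[x xS]; exists x; apply/eqP.
rewrite eqn_leq nonadj_leq_alpha //= -aS; apply: subset_leq_card.
apply/subsetP => y yS; rewrite inE.
by move: iS => /forall_inP/(_ x xS)/forall_inP/(_ y yS).
Qed.

Lemma alpha_leq_card (G : sgraph) : (alpha G <= #|G|)%N.
Proof. by apply/bigmax_leqP => S _; apply: max_card. Qed.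

Lemma beta_gt0 (R : realType) (G : sgraph) :
  complete_multipartite G -> 0 < beta R G.
Proof.
move=> cG; have [x ax] := nonadj_eq_alpha cG.
rewrite /beta -ax divr_gt0 ?ltr0n ?complete_multipartite_gt0 //.
by apply/card_gt0P; exists x; rewrite inE adj_irr.
Qed.

Lemma beta_le1 (R : realType) (G : sgraph) :
  complete_multipartite G -> beta R G <= 1.
Proof.
move=> cG; rewrite /beta ler_pdivrMr ?ltr0n ?complete_multipartite_gt0 // mul1r.
by rewrite ler_nat alpha_leq_card.
Qed.

Definition prod_rel (T K : finType) (e : rel T) (e' : rel K) : rel (T * K) :=
  fun v w => e v.1 w.1 && e' v.2 w.2.

Lemma card_fibers (T K : finType) (S : {set T * K}) :
  #|S| = (\sum_(v : T) #|[set k | (v, k) \in S]|)%N.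
Proof.
rewrite -sum1_card (eq_bigl (fun p => true && ((p.1, p.2) \in S))) => [|[]] //.
rewrite -(pair_big_dep predT (fun v k => (v, k) \in S) (fun _ _ => 1%N)) /=.
by apply: eq_bigr => v _; rewrite sum1_card cardsE.
Qed.

Lemma card_indicator (T : finType) (A : {set T}) : #|A| = (\sum_v (v \in A))%N.
Proof. by rewrite -sum1_card big_mkcond. Qed.

(** * Products with a complete multipartite graph *)

Section ProductWithMultipartite.
Variables (T : finType) (e : rel T) (K : sgraph).
Hypothesis cK : complete_multipartite K.

Definition fiber_support (S : {set T * K}) : {set T} :=
  [set v | [exists k, (v, k) \in S]].

(** The set [W] of the compression, [fiber_support] being [U]: a fibre meets two parts iff it
    contains two adjacent vertices. *)
Definition fiber_spread (S : {set T * K}) : {set T} :=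
  [set v | [exists k, exists k', [&& adj k k', (v, k) \in S & (v, k') \in S]]].

Lemma fiber_spread_sub S : fiber_spread S \subset fiber_support S.
Proof.
apply/subsetP => v; rewrite !inE => /existsP[k /existsP[k' /and3P[_ vk _]]].
by apply/existsP; exists k.
Qed.

(** A fibre over [U] but not over [W] lies in one part, so it has at most [alpha K] elements. *)
Lemma card_fiber_bound (S : {set T * K}) :
  (#|S| <= alpha K * #|fiber_support S|
           + (#|K| - alpha K) * #|fiber_spread S|)%N.
Proof.
rewrite card_fibers !card_indicator !big_distrr -big_split /=.
apply: leq_sum => v _; have aK := alpha_leq_card K.
have [vW|vW] := boolP (v \in fiber_spread S).
  rewrite (subsetP (fiber_spread_sub S) _ vW) !muln1 subnKC //.
  exact: max_card.
have [|vU] := boolP (v \in fiber_support S).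
  rewrite inE => /existsP[k vk]; rewrite muln1 muln0 addn0.
  apply: leq_trans (nonadj_leq_alpha k cK); apply: subset_leq_card.
  apply/subsetP => k'; rewrite !inE => vk'; apply: contra vW => kk'.
  by rewrite inE; apply/existsP; exists k; apply/existsP; exists k'; rewrite kk' vk.
rewrite eq_card0 // => k; rewrite !inE; apply/negbTE.
by apply: contra vU => vk; rewrite inE; apply/existsP; exists k.
Qed.

(** Two adjacent vertices of [K] together have all of [K] as neighbours, so the boundary is full
    over the neighbours of [W]. Over the other neighbours of [U] it contains at least the complement
    of a part. *)
Lemma card_boundary_bound (S : {set T * K}) :
  ((#|K| - alpha K) * #|vboundary e (fiber_support S)|
   + alpha K * #|vboundary e (fiber_spread S)|
   <= #|vboundary (prod_rel e (@adj K)) S|)%N.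
Proof.
rewrite (card_fibers (vboundary _ S)) !card_indicator !big_distrr -big_split /=.
apply: leq_sum => w _; have aK := alpha_leq_card K.
have [wW|wW] := boolP (w \in vboundary e (fiber_spread S)).
  rewrite (subsetP (vboundaryS _ (fiber_spread_sub S)) _ wW) !muln1 subnK //.
  rewrite (_ : [set k | _] = setT) ?cardsT //.
  apply/setP => k0; rewrite !inE.
  case/vboundaryP: wW => v; rewrite inE.
  move=> /existsP[k /existsP[k' /and3P[kk' vk vk']]] evw.
  have /orP[h|h] := complete_multipartite_trans cK k0 kk'.
    by apply/existsP; exists (v, k); rewrite vk /prod_rel /= evw.
  by apply/existsP; exists (v, k'); rewrite vk' /prod_rel /= evw.
rewrite muln0 addn0.
have [/vboundaryP[v]|wU] := boolP (w \in _); last by rewrite muln0.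
rewrite inE => /existsP[k vk] evw; rewrite muln1.
apply: leq_trans (_ : #|~: [set y | ~~ adj k y]| <= _)%N.
  have := cardsC [set y | ~~ adj k y]; have := nonadj_leq_alpha k cK.
  by rewrite -[#|K|]/(#|vertex K|); lia.
apply: subset_leq_card; apply/subsetP => k'; rewrite !inE negbK => kk'.
by apply/existsP; exists (v, k); rewrite vk /prod_rel /= evw.
Qed.

(** The witness is [U] times a largest part, the one of [k0], together with [W] times [K]. Over a
    point outside the boundary of [W], its boundary avoids the part of [k0]. *)
Lemma nested_lift (U W : {set T}) : W \subset U ->
  exists S : {set T * K},
    (alpha K * #|U| + (#|K| - alpha K) * #|W| <= #|S|)%N /\
    (#|vboundary (prod_rel e (@adj K)) S| <=
      (#|K| - alpha K) * #|vboundary e U| + alpha K * #|vboundary e W|)%N.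
Proof.
move=> sWU; have [k0 ak0] := nonadj_eq_alpha cK; have aK := alpha_leq_card K.
have cC : #|[set k | adj k0 k]| = (#|K| - alpha K)%N.
  have := cardsC [set y | ~~ adj k0 y]; rewrite ak0.
  rewrite (_ : ~: _ = [set k | adj k0 k]); last by apply/setP => y; rewrite !inE negbK.
  by rewrite -[#|K|]/(#|vertex K|); lia.
exists [set p | (p.1 \in W) || (p.1 \in U) && ~~ adj k0 p.2]; split.
  rewrite card_fibers !card_indicator !big_distrr -big_split /=.
  apply: leq_sum => v _.
  have [vW|vW] := boolP (v \in W).
    rewrite (subsetP sWU _ vW) !muln1 subnKC // (_ : [set k | _] = setT) ?cardsT //.
    by apply/setP => k; rewrite !inE /= vW.
  rewrite muln0 addn0; have [vU|vU] := boolP (v \in U); last by rewrite muln0.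
  rewrite muln1 -ak0 subset_leq_card //; apply/subsetP => k.
  by rewrite !inE /= vU orbC => ->.
rewrite card_fibers !card_indicator !big_distrr -big_split /=.
apply: leq_sum => w _.
have [wW|wW] := boolP (w \in vboundary e W).
  rewrite (subsetP (vboundaryS _ sWU) _ wW) !muln1 subnK //.
  exact: max_card.
rewrite muln0 addn0.
have notW v k : (v, k) \in [set p : T * K | (p.1 \in W) || (p.1 \in U) && ~~ adj k0 p.2] ->
    e v w -> (v \in U) && ~~ adj k0 k.
  rewrite inE /= => /orP[vW evw|] //.
  by case/negP: wW; apply/vboundaryP; exists v.
have [wU|wU] := boolP (w \in vboundary e U).
  rewrite muln1 -cC subset_leq_card //; apply/subsetP => k; rewrite inE.
  case/vboundaryP => -[v k'] vk' /andP[/= evw kk'].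
  have /andP[_ h] := notW _ _ vk' evw; rewrite inE.
  have := complete_multipartite_trans cK k0 kk'.
  by rewrite adj_sym (negPf h) adj_sym.
rewrite muln0 leqn0 cards_eq0 -subset0; apply/subsetP => k; rewrite inE.
case/vboundaryP => -[v k'] vk' /andP[/= evw _].
have /andP[vU _] := notW _ _ vk' evw.
by case/negP: wU; apply/vboundaryP; exists v.
Qed.

End ProductWithMultipartite.

(** * Attainable pairs of a product *)

Section ProductProfile.
Variables (R : realType) (T : finType) (e : rel T) (K : sgraph).
Hypotheses (T_gt0 : (0 < #|T|)%N) (cK : complete_multipartite K).
Local Notation b := (beta R K).

Lemma mix_density (u w : nat) :
  (alpha K * u + (#|K| - alpha K) * w)%N%:R / #|{: T * K}|%:R
  = b * (u%:R / #|T|%:R) + (1 - b) * (w%:R / #|T|%:R) :> R.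
Proof.
have K0 : #|K|%:R != 0 :> R.
  by rewrite pnatr_eq0 -lt0n complete_multipartite_gt0.
have T0 : #|T|%:R != 0 :> R by rewrite pnatr_eq0 -lt0n.
rewrite /beta card_prod natrD !natrM natrB ?alpha_leq_card //.
by field; rewrite K0 T0.
Qed.

Lemma mix_density_swap (u w : nat) :
  ((#|K| - alpha K) * u + alpha K * w)%N%:R / #|{: T * K}|%:R
  = (1 - b) * (u%:R / #|T|%:R) + b * (w%:R / #|T|%:R) :> R.
Proof. by rewrite addnC mix_density addrC. Qed.

(** Compression of [S] to its support and spread. The converse needs more, since [mix] does not
    record nested sets. *)
Lemma profile_prod_mix x t :
  profile (prod_rel e (@adj K)) x t -> mix b (@profile R T e) x t.
Proof.
move=> [x0 t1 [S [hx ht]]].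
have sWU := fiber_spread_sub S.
have prof A : profile e (density R A) (density R (vboundary e A)).
  by split; [apply: density_ge0|apply: density_le1|exists A].
exists (density R (fiber_support S)), (density R (fiber_spread S)),
  (density R (vboundary e (fiber_support S))),
  (density R (vboundary e (fiber_spread S))).
split; [exact: prof|exact: prof| |].
  by split; apply: densityS => //; apply: vboundaryS.
split.
  apply: le_trans hx _; rewrite -mix_density ler_wpM2r ?invr_ge0 // ler_nat.
  exact: card_fiber_bound.
apply: le_trans ht; rewrite -mix_density_swap ler_wpM2r ?invr_ge0 // ler_nat.
exact: card_boundary_bound.
Qed.

Lemma profile_prod_nested (U W : {set T}) x t : W \subset U -> 0 <= x -> t <= 1 ->
    x <= b * density R U + (1 - b) * density R W ->
    (1 - b) * density R (vboundary e U) + b * density R (vboundary e W) <= t ->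
  profile (prod_rel e (@adj K)) x t.
Proof.
move=> sWU x0 t1 hx ht; have [S [hS hdS]] := nested_lift e cK sWU.
split=> //; exists S; split.
  by apply: le_trans hx _; rewrite -mix_density ler_wpM2r ?invr_ge0 // ler_nat.
by apply: le_trans ht; rewrite -mix_density_swap ler_wpM2r ?invr_ge0 // ler_nat.
Qed.

(** The nested pair with [W] empty. *)
Lemma profile_prod_small x t :
  profile e x t -> profile (prod_rel e (@adj K)) (b * x) ((1 - b) * t).
Proof.
move=> h; have [x0 x1 t0 t1] := profile_bounds h; case: h => _ _ [S [hx ht]].
have b0 := beta_gt0 R cK; have b1 := beta_le1 R cK.
apply: (profile_prod_nested (sub0set S)); rewrite ?vboundary0 ?density0 //.
- by rewrite mulr_ge0 // ltW.
- by rewrite mulr_ile1 // ?subr_ge0 //; lra.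
- by rewrite mulr0 addr0 ler_pM2l.
- by rewrite mulr0 addr0 ler_wpM2l // subr_ge0.
Qed.

(** The nested pair with [U] everything. *)
Lemma profile_prod_large x t : profile e x t ->
  profile (prod_rel e (@adj K)) (b + (1 - b) * x) (1 - b + b * t).
Proof.
move=> h; have [x0 x1 t0 t1] := profile_bounds h; case: h => _ _ [S [hx ht]].
have b0 := beta_gt0 R cK; have b1 := beta_le1 R cK.
have b1' : 0 <= 1 - b by rewrite subr_ge0.
apply: (profile_prod_nested (subsetT S)); rewrite ?densityT //.
- by apply: addr_ge0; [apply: ltW|apply: mulr_ge0].
- have : b * t <= b by rewrite ger_pMr.
  by lra.
- by rewrite mulr1 lerD2l ler_wpM2l.
- by apply: lerD; [rewrite ler_piMr ?density_le1|rewrite ler_pM2l].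
Qed.

(* The two sets need not be nested, but for [b >= 1/2] replacing them by their
   union and intersection does not decrease the density, and does not increase
   the boundary by submodularity. *)
Lemma mix_profile_prod_half x t : 1 / 2 <= b -> 0 <= x -> t <= 1 ->
  mix b (@profile R T e) x t -> profile (prod_rel e (@adj K)) x t.
Proof.
move=> b2 x0 t1.
move=> [x1 [x2 [t1' [t2 [[_ _ [U [hU hdU]]] [_ _ [W [hW hdW]]] [x21 t21] [hx ht]]]]]].
have b1 := beta_le1 R cK.
have EUW : density R (U :|: W) + density R (U :&: W) = density R U + density R W.
  by rewrite /density -!mulrDl -!natrD cardsUI.
have sUI : density R (U :&: W) <= density R W by apply/densityS/subsetIr.
have sUI1 : density R (U :&: W) <= density R U by apply/densityS/subsetIl.
set B1 := vboundary e U; set B2 := vboundary e W.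
have EB : density R (B1 :|: B2) + density R (B1 :&: B2) = density R B1 + density R B2.
  by rewrite /density -!mulrDl -!natrD cardsUI.
have sB : density R (vboundary e (U :&: W)) <= density R (B1 :&: B2).
  by apply/densityS; rewrite subsetI !vboundaryS ?subsetIl ?subsetIr.
have sB1 : density R (B1 :&: B2) <= density R B2 by apply/densityS/subsetIr.
apply: (@profile_prod_nested (U :|: W) (U :&: W)) => //.
- exact: subset_trans (subsetIl _ _) (subsetUl _ _).
(* The density grows by [2 * b - 1] times that of [W] minus [U]. *)
- move: hU hW EUW sUI sUI1; nra.
- rewrite vboundaryU -/B1 -/B2.
  move: hdU hdW EB sB sB1; rewrite -/B1 -/B2; nra.
Qed.

Lemma mix_profile_prod_subadditive x t : region (@profile R T e) -> b < 1 ->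
    subadditive ((1 - b) / b) (@profile R T e) -> 0 <= x -> t <= 1 ->
  mix b (@profile R T e) x t -> profile (prod_rel e (@adj K)) x t.
Proof.
move=> rD b1 sD x0 t1 m; have b0 := beta_gt0 R cK.
have b1' : 0 < 1 - b by rewrite subr_gt0.
have := mix_explicit rD b0 b1 sD m x0 t1; case: ifP => _ h.
  have := profile_prod_small h; rewrite [b * _]mulrC divfK ?gt_eqF // => h'.
  apply: (profile_mono h') => //.
  rewrite -[leRHS](divfK (lt0r_neq0 b1')) [leRHS]mulrC ler_pM2l //.
  by rewrite ge_min lexx orbT.
have := profile_prod_large h.
rewrite [_ * (_ / (1 - b))]mulrC divfK ?gt_eqF // [b * _]mulrC divfK ?gt_eqF //.
by rewrite !subrKC.
Qed.

End ProductProfile.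

(** * The isoperimetric profile as least attainable boundary *)

Section IsoperimetricProfile.
Variables (R : realType) (V : finType) (e : rel V).
Hypothesis V_gt0 : (0 < #|V|)%N.

Definition vPhi (nu : R) : R :=
  density R (vboundary e
    [arg min_(S < [set: V] | nu <= density R S) density R (vboundary e S)]%O).

Lemma vPhi_profile nu : 0 <= nu -> nu <= 1 -> profile e nu (vPhi nu).
Proof.
move=> nu0 nu1; rewrite /vPhi.
case: arg_minP => [|S hS _]; first by rewrite densityT.
by split=> //; [apply: density_le1|exists S].
Qed.

Lemma vPhi_le nu t : profile e nu t -> vPhi nu <= t.
Proof.
move=> [nu0 t1 [S [hS ht]]]; apply: le_trans ht.
rewrite /vPhi; case: arg_minP => [|A _ minA]; last exact: minA.
by rewrite densityT // (le_trans hS) ?density_le1.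
Qed.

Lemma vPhi_ge0 nu : 0 <= vPhi nu.
Proof. exact: density_ge0. Qed.

Lemma vPhi0 : vPhi 0 = 0.
Proof.
apply/eqP; rewrite eq_le vPhi_ge0 andbT; apply: vPhi_le.
by split=> //; exists set0; rewrite vboundary0 density0.
Qed.

End IsoperimetricProfile.

(** * Base case: all pairs related *)

Section FullRelation.
Variables (R : realType) (V : finType) (e : rel V).
Hypotheses (V_gt0 : (0 < #|V|)%N) (e_full : forall v w, e v w).

Lemma full_profile (x t : R) : profile e x t -> x <= 0 \/ 1 <= t.
Proof.
move=> [_ _ [S [hx ht]]]; have [S0|[v vS]] := set_0Vmem S.
  by left; rewrite S0 density0 in hx.
right; rewrite (_ : vboundary e S = setT) ?densityT // in ht.
by apply/setP => w; rewrite in_setT; apply/vboundaryP; exists v.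
Qed.

Lemma full_region : region (@profile R V e).
Proof.
apply: profile_region => // [v w|t /full_profile[]//]; first by rewrite !e_full.
by rewrite ler10.
Qed.

(** Here [f] is 0 at 0 and 1 elsewhere. In the critical case [x = 0 < y] the order condition leaves
    [r <= 1], so [f y / r >= 1]. *)
Lemma full_subadditive r : 0 < r -> subadditive r (@profile R V e).
Proof.
move=> r0 x y t u Dx Dy hr; have rD := full_region.
have [x0 x1 t0 t1] := region_bounds rD Dx.
have [y0 y1 u0 u1] := region_bounds rD Dy.
have u_r : 0 <= u / r by rewrite divr_ge0 // ltW.
have x_ge0 : 0 <= Num.min 1 (x + r * y).
  by rewrite le_min ler01 addr_ge0 ?mulr_ge0 // ltW.
have full : 1 <= t + u / r ->
    profile e (Num.min 1 (x + r * y)) (Num.min 1 (t + u / r)).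
  move=> tu; rewrite (min_l tu).
  by apply: (region_mono rD (region11 rD)) => //; rewrite ge_min lexx.
case: (full_profile Dx) => [x_le0|t_ge1]; last by apply: full; lra.
have [y_le0|y_gt0] := leP y 0.
  have -> : x = 0 by lra.
  have -> : y = 0 by lra.
  rewrite mulr0 addr0 min_r //.
  by apply: (region_mono rD (region00 rD)); rewrite // ?le_min ?ler01 ?ge_min ?lexx ?addr_ge0.
case: (full_profile Dy) => [|u_ge1]; first by lra.
case: hr => [r1|yx]; last by lra.
apply: full; have : 1 <= u / r by rewrite ler_pdivlMr // mul1r; lra.
by lra.
Qed.

Lemma full_vPhi nu : 0 < nu -> nu <= 1 -> vPhi e nu = 1 :> R.
Proof.
move=> nu0 nu1; apply/eqP; rewrite eq_le density_le1 /=.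
have /full_profile[] // := vPhi_profile e V_gt0 (ltW nu0) nu1.
by lra.
Qed.

End FullRelation.

(** * Adding one complete multipartite factor *)

Section Step.
Variables (R : realType) (V T : finType) (eV : rel V) (e : rel T) (K : sgraph).
Variable f : V -> T * K.
Hypotheses (T_gt0 : (0 < #|T|)%N) (cK : complete_multipartite K).
Hypothesis f_bij : bijective f.
Hypothesis f_rel : forall v w, eV v w = prod_rel e (@adj K) (f v) (f w).
Local Notation b := (beta R K).

Lemma step_profile (x t : R) : profile eV x t <-> profile (prod_rel e (@adj K)) x t.
Proof.
split; first exact: profile_bij f_bij f_rel.
have [g fK gK] := f_bij; apply: (@profile_bij _ _ _ _ _ g).
  by exists f.
by move=> v w; rewrite f_rel !gK.
Qed.

Lemma step_card_gt0 : (0 < #|V|)%N.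
Proof.
by rewrite (bij_eq_card f_bij) card_prod muln_gt0 T_gt0 complete_multipartite_gt0.
Qed.

Lemma step_region : region (@profile R T e) -> symmetric eV -> b < 1 ->
  region (@profile R V eV).
Proof.
move=> rD symV b1; apply: profile_region symV _; first exact: step_card_gt0.
move=> t /step_profile/(profile_prod_mix T_gt0 cK).
exact: mix_top rD (beta_gt0 R cK) b1.
Qed.

(** The last hypothesis turns [mix] back into sets of the product: by union and intersection if
    [1 / 2 <= b], otherwise by the explicit optimum. If [1 / 2 <= b], then also [r <= 1], and no
    order condition arises. *)
Lemma step_subadditive r : region (@profile R T e) -> b < 1 -> 0 < r -> r <= (1 - b) / b ->
    subadditive r (@profile R T e) ->
    subadditive (r / ((1 - b) / b)) (@profile R T e) ->
    1 / 2 <= b \/ subadditive ((1 - b) / b) (@profile R T e) ->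
  subadditive r (@profile R V eV).
Proof.
move=> rD b1 r0 r_rho sr sr' hb x y t u Dx Dy hr.
have b0 := beta_gt0 R cK.
have [x0 x1 t0 t1] := profile_bounds Dx.
have [y0 y1 u0 u1] := profile_bounds Dy.
move: Dx Dy => /step_profile/(profile_prod_mix T_gt0 cK) mx.
move=> /step_profile/(profile_prod_mix T_gt0 cK) my.
have hb' : r <= 1 \/ subadditive ((1 - b) / b) (@profile R T e).
  case: hb => [hb|]; [left|by right].
  by apply: le_trans r_rho _; rewrite ler_pdivrMr //; lra.
have m := subadditive_mix rD b0 b1 r0 r_rho sr sr' hb' x0 y0 t1 u1 mx my hr.
have x_ge0 : 0 <= Num.min 1 (x + r * y).
  by rewrite le_min ler01 addr_ge0 ?mulr_ge0 // ltW.
have t_le1 : Num.min 1 (t + u / r) <= 1 by rewrite ge_min lexx.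
apply/step_profile; case: hb => [hb|hb].
  exact: mix_profile_prod_half m.
exact: mix_profile_prod_subadditive m.
Qed.

Hypothesis rD : b < 1 -> region (@profile R T e).
Hypothesis sD : b < 1 -> subadditive ((1 - b) / b) (@profile R T e).

Lemma step_vPhi_small (nu : R) : 0 < nu -> nu <= b ->
  vPhi eV nu = (1 - b) * vPhi e (nu / b).
Proof.
move=> nu0 nub; have b0 := beta_gt0 R cK; have b1 := beta_le1 R cK.
have nub1 : nu / b <= 1 by rewrite ler_pdivrMr // mul1r.
have nub0 : 0 <= nu / b by rewrite divr_ge0 // ltW.
have V0 := step_card_gt0.
apply/eqP; rewrite eq_le; apply/andP; split.
  apply: vPhi_le => //; apply/step_profile.
  have := profile_prod_small T_gt0 cK (vPhi_profile e T_gt0 nub0 nub1).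
  by rewrite [b * _]mulrC divfK // gt_eqF.
(* For [b = 1] the right-hand side is 0. *)
have [b1'|b1'] := ltP b 1; last first.
  by have -> : b = 1 by [lra]; rewrite subrr mul0r vPhi_ge0.
have nu1 : nu <= 1 by lra.
have h := vPhi_profile eV V0 (ltW nu0) nu1.
have [_ _ _ le1] := profile_bounds h.
move/step_profile/(profile_prod_mix T_gt0 cK): h => m.
have := mix_explicit (rD b1') b0 b1' (sD b1') m (ltW nu0) le1.
rewrite nub => /(vPhi_le T_gt0).
by rewrite le_min ler_pdivlMr ?subr_gt0 // => /andP[_]; rewrite mulrC.
Qed.

Lemma step_vPhi_large (nu : R) : b < nu -> nu <= 1 ->
  vPhi eV nu = 1 - b + b * vPhi e ((nu - b) / (1 - b)).
Proof.
move=> bnu nu1; have b0 := beta_gt0 R cK; have b1 : b < 1 by lra.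
have b1' : 0 < 1 - b by rewrite subr_gt0.
have V0 := step_card_gt0; have nu0 : 0 <= nu by lra.
apply/eqP; rewrite eq_le; apply/andP; split.
  have z0 : 0 <= (nu - b) / (1 - b) by rewrite divr_ge0 ?subr_ge0 // ltW.
  have z1 : (nu - b) / (1 - b) <= 1 by rewrite ler_pdivrMr //; lra.
  apply: vPhi_le => //; apply/step_profile.
  have := profile_prod_large T_gt0 cK (vPhi_profile e T_gt0 z0 z1).
  by rewrite [_ * (_ / _)]mulrC divfK ?gt_eqF // subrKC.
have h := vPhi_profile eV V0 nu0 nu1.
have [_ _ _ le1] := profile_bounds h.
move/step_profile/(profile_prod_mix T_gt0 cK): h => m.
have := mix_explicit (rD b1) b0 b1 (sD b1) m nu0 le1.
rewrite leNgt bnu /= => /(vPhi_le T_gt0).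
by rewrite ler_pdivlMr // mulrC; lra.
Qed.

End Step.

(** * Direct products of complete multipartite graphs *)

Section SplitLast.
Variables (n : nat) (H : 'I_n.+1 -> sgraph).

Definition split_last (v : dprod_vertex H) :
    dprod_vertex (init_factors H) * H ord_max :=
  ([ffun k : 'I_n => (v (widen_ord (leqnSn n) k) : init_factors H k)], v ord_max).

Lemma ord_max_or_widen (P : 'I_n.+1 -> Prop) :
  (forall k : 'I_n, P (widen_ord (leqnSn n) k)) -> P ord_max -> forall k, P k.
Proof.
move=> Pw Pm k; have [j ->|->//] := unliftP ord_max k.
rewrite (_ : lift _ _ = widen_ord (leqnSn n) j) //.
by apply: val_inj; rewrite /= /bump leqNgt ltn_ord.
Qed.

Lemma dprod_vertex_card m (F : 'I_m -> sgraph) :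
  #|dprod_vertex F| = (\prod_k #|F k|)%N.
Proof. by rewrite card_dep_ffun foldrE big_image. Qed.

Lemma split_last_bij : bijective split_last.
Proof.
apply: inj_card_bij => [v w [/ffunP vw eqm]|].
  apply/ffunP; apply: ord_max_or_widen => // k.
  by have := vw k; rewrite !ffunE.
by rewrite card_prod !dprod_vertex_card big_ord_recr.
Qed.

Lemma split_last_adj v w : dprod_adj v w =
  prod_rel (@dprod_adj n (init_factors H)) (@adj (H ord_max))
    (split_last v) (split_last w).
Proof.
apply/forallP/andP => [h|[/forallP h hm]].
  by split=> //=; apply/forallP => k; rewrite !ffunE; apply: h.
apply: ord_max_or_widen => // k.
by have := h k; rewrite !ffunE.
Qed.

End SplitLast.

Lemma dprod_vertex_gt0 n (H : 'I_n -> sgraph) :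
  (forall k, complete_multipartite (H k)) -> (0 < #|dprod_vertex H|)%N.
Proof.
move=> cH; rewrite dprod_vertex_card prodn_gt0 // => k.
exact: complete_multipartite_gt0.
Qed.

Section DirectProductProfile.
Variable R : realType.
Local Notation rho G := ((1 - beta R G) / beta R G).

Lemma rho_le (G K : sgraph) : complete_multipartite G ->
  complete_multipartite K -> beta R G <= beta R K -> rho K <= rho G.
Proof.
move=> /(beta_gt0 R) G0 /(beta_gt0 R) K0 h.
by rewrite ler_pdivrMr // mulrAC ler_pdivlMr //; lra.
Qed.

Lemma le_prod_of_ge1 (I : finType) (A : {set I}) (F : I -> R) (c : R) :
  1 <= c -> (forall i, c <= F i) -> A != set0 -> c <= \prod_(i in A) F i.
Proof.
move=> c1 cF /set0Pn[i iA]; rewrite (bigD1 i) //=.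
have F1 j : 1 <= F j by apply: le_trans (cF j).
apply: le_trans (cF i) _; rewrite ler_peMr ?(le_trans ler01) //.
by apply: (big_ind (fun y => 1 <= y)) => // y z y1 z1; apply: mulr_ege1.
Qed.

(** Induction for all [r] at once: with [rho] the ratio of the last factor, the step needs the claim
    for [r], for [r / rho] and, if the last [beta] is below 1/2, for [rho]. *)
Lemma dprod_region_subadditive n (H : 'I_n -> sgraph) :
    (forall k, complete_multipartite (H k)) ->
    (forall i j : 'I_n, (i <= j)%N -> beta R (H i) <= beta R (H j)) ->
    (forall k, beta R (H k) < 1) ->
  region (@profile R _ (@dprod_adj n H)) /\
  forall r, 0 < r ->
    (forall A : {set 'I_n}, A != set0 -> r <= \prod_(k in A) rho (H k)) ->
    subadditive r (@profile R _ (@dprod_adj n H)).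
Proof.
elim: n H => [|n IHn] H cH mono lt1.
  have full v w : @dprod_adj 0 H v w by apply/forallP => -[].
  split; first exact/full_region/full/dprod_vertex_gt0.
  by move=> r r0 _; apply: full_subadditive => //; apply: dprod_vertex_gt0.
pose wd := widen_ord (leqnSn n).
have wd_inj : injective wd by move=> i j /(congr1 val)/= /val_inj.
have cI k : complete_multipartite (init_factors H k) by apply: cH.
have [||rD sD] := IHn (init_factors H) cI.
- by move=> i j ij; apply: mono.
- by move=> k; apply: lt1.
have T0 := dprod_vertex_gt0 cI.
have cK := cH ord_max; have b0 := beta_gt0 R cK; have b1 := lt1 ord_max.
have rho0 : 0 < rho (H ord_max) by rewrite divr_gt0 // subr_gt0.
split.
  apply: (step_region T0 cK (split_last_bij H) (@split_last_adj n H)) => //.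
  exact: dprod_sym.
move=> r r0 hr.
apply: (step_subadditive T0 cK (split_last_bij H) (@split_last_adj n H)) => //.
- have := hr [set ord_max]; rewrite big_set1; apply.
  by apply/set0Pn; exists ord_max; rewrite set11.
- apply: sD => // A A0; have := hr (wd @: A).
  rewrite imset_eq0 big_imset; last by move=> ? ? _ _; apply: wd_inj.
  exact.
(* Dividing the bounds for products that contain the last factor by its ratio. *)
- apply: sD => [|A A0]; first by rewrite divr_gt0.
  have := hr (ord_max |: wd @: A); rewrite big_setU1 /=; last first.
    apply/imsetP => -[k _ /(congr1 val)/= nk].
    by have := ltn_ord k; rewrite -nk ltnn.
  rewrite big_imset; last by move=> ? ? _ _; apply: wd_inj.
  rewrite ler_pdivrMr // mulrC; apply.
  by apply/set0Pn; exists ord_max; rewrite setU11.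
(* Below 1/2 the last ratio exceeds 1 and, by monotonicity, no earlier ratio is smaller, so it
   bounds all nonempty products from below. *)
- have [h|h] := leP (1 / 2) (beta R (H ord_max)); [by left|right].
  apply: sD => // A; apply: le_prod_of_ge1.
    by rewrite ler_pdivlMr // mul1r; lra.
  by move=> k; apply: rho_le => //; apply: mono => /=; apply: ltnW.
Qed.

End DirectProductProfile.

(* The graphs H_1, ..., H_(n+1) are H ord0, ..., H ord_max. *)
Theorem theorem1p5 (R : realType) (n : nat) (H : 'I_n.+1 -> sgraph)
    (H_multipartite : forall k : 'I_n.+1, complete_multipartite (H k))
    (beta_mono : forall i j : 'I_n.+1, (i <= j)%N -> beta R (H i) <= beta R (H j))
    (beta_prod : forall A : {set 'I_n}, A != set0 ->
       (1 - beta R (H ord_max)) / beta R (H ord_max) <=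
       \prod_(k in A)
         ((1 - beta R (init_factors H k)) / beta R (init_factors H k))) :
  [/\ Phi (H ord0) (0 : R) = 0,
      forall nu : R, 0 < nu <= beta R (H ord0) ->
        Phi (H ord0) nu = 1 - beta R (H ord0)
    & forall nu : R, beta R (H ord0) < nu <= 1 -> Phi (H ord0) nu = 1]
  /\
  forall n_gt0 : (0 < n)%N,
    let b : R := beta R (H ord_max) in
    let G : sgraph := dprod (ltn0Sn n) H in
    let G' : sgraph := dprod n_gt0 (init_factors H) in
    [/\ Phi G (0 : R) = 0,
        forall nu : R, 0 < nu <= b -> Phi G nu = (1 - b) * Phi G' (nu / b)
      & forall nu : R, b < nu <= 1 ->
          Phi G nu = 1 - b + b * Phi G' ((nu - b) / (1 - b))].
Proof.
split.
  have cK := H_multipartite ord0.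
  have b0 := beta_gt0 R cK; have b1 := beta_le1 R cK.
  (* A single graph is its product with one looped vertex. *)
  pose f (v : H ord0) := (tt, v); pose e (_ _ : unit) := true.
  have T0 : (0 < #|{: unit}|)%N by rewrite card_unit.
  have f_bij : bijective f by exists snd => [|[[] v]].
  have f_rel v w : adj v w = prod_rel e (@adj (H ord0)) (f v) (f w) by [].
  have rD := @full_region R _ e T0 (fun _ _ => erefl).
  have sD : beta R (H ord0) < 1 ->
      subadditive ((1 - beta R (H ord0)) / beta R (H ord0)) (@profile R _ e).
    by move=> b_lt1; apply: full_subadditive; rewrite // divr_gt0 ?subr_gt0.
  have PhiE nu : Phi (H ord0) nu = vPhi (@adj (H ord0)) nu :> R by [].
  split=> [|nu /andP[nu0 nub]|nu /andP[bnu nu1]]; rewrite PhiE.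
  - exact/vPhi0/complete_multipartite_gt0.
  - rewrite (step_vPhi_small T0 cK f_bij f_rel (fun _ => rD) sD) // full_vPhi ?mulr1 //.
      by rewrite divr_gt0.
    by rewrite ler_pdivrMr // mul1r.
  - have b_lt1 : 0 < 1 - beta R (H ord0) by lra.
    rewrite (step_vPhi_large T0 cK f_bij f_rel (fun _ => rD) sD) // full_vPhi ?mulr1 ?subrK //.
      by rewrite divr_gt0 // subr_gt0.
    by rewrite ler_pdivrMr // mul1r lerD2r.
move=> n_gt0 b G G'.
have cK := H_multipartite ord_max.
have cI k : complete_multipartite (init_factors H k) by apply: H_multipartite.
have T0 := dprod_vertex_gt0 cI.
have b0 : 0 < b := beta_gt0 R cK; have b1 : b <= 1 := beta_le1 R cK.
have PhiE nu : Phi G nu = vPhi (@dprod_adj _ H) nu :> R by [].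
have PhiE' nu : Phi G' nu = vPhi (@dprod_adj _ (init_factors H)) nu :> R by [].
have V0 := dprod_vertex_gt0 H_multipartite.
(* For [b < 1] monotonicity keeps every [beta] below 1, and [beta_prod] is the condition on products
   for [r = (1 - b) / b]. *)
have rsD : b < 1 -> region (@profile R _ (@dprod_adj n (init_factors H))) /\
    subadditive ((1 - b) / b) (@profile R _ (@dprod_adj n (init_factors H))).
  move=> b_lt1; have [||rD sD] := dprod_region_subadditive cI (R := R).
  - by move=> i j ij; apply: beta_mono.
  - by move=> k; apply: le_lt_trans b_lt1; apply: beta_mono => /=; apply: ltnW.
  - by split=> //; apply: sD => //; rewrite divr_gt0 // subr_gt0.
split=> [|nu /andP[nu0 nub]|nu /andP[bnu nu1]]; rewrite ?PhiE ?PhiE'.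
- exact: vPhi0.
- by apply: (step_vPhi_small T0 cK (split_last_bij H) (@split_last_adj n H)) => // b_lt1;
    have [] := rsD b_lt1.
- by apply: (step_vPhi_large T0 cK (split_last_bij H) (@split_last_adj n H)) => // b_lt1;
    have [] := rsD b_lt1.
Qed.
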